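(* Let $X$ be an infinite-dimensional real Banach space that is both uniformly rotund and uniformly smooth. Then the following assertions hold. (i) If $\mathrm{dens}(X)<2^{\aleph_0}$, then $X$ does not admit a point-finite covering by open or closed balls, each of positive radius. (ii) If $\mathcal{B}$ is a covering of $X$ by open balls (of positive radius), then $\mathcal{B}$ is not point-finite.
   Context: $\mathrm{dens}(X)$ denotes the density character of $X$, i.e. the smallest cardinality of a dense subset of $X$. A family of subsets of $X$ is a covering of $X$ if the union of its members is $X$. It is point-finite if each $x\in X$ belongs to at most finitely many members of the family. ''A covering by open or closed balls'' means that each member is either an open ball or a closed ball; both kinds may occur in the same covering. ''Uniformly rotund'' is the same as uniformly convex. Uniform rotundity and uniform smoothness refer to the given norm of $X$, and balls are taken with respect to that norm. *)

(* Defs.v *)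
From HB Require Import structures.
From mathcomp Require Export all_boot all_order all_algebra.
From mathcomp Require Export all_classical all_reals all_analysis.
Export numFieldNormedType.Exports.

Set Implicit Arguments.
Unset Strict Implicit.
Unset Printing Implicit Defensive.

Import Order.TTheory GRing.Theory Num.Theory.
Local Open Scope classical_set_scope.
Local Open Scope card_scope.
Local Open Scope ring_scope.

Definition infinite_dimensional (R : realType) (X : lmodType R) : Prop :=
  forall (n : nat) (e : 'I_n -> X),
    ~ (forall x : X, exists c : 'I_n -> R, x = \sum_(i < n) c i *: e i).

(** Clarkson's definition: the modulus of convexity is positive on ]0, 2]
    (for eps > 2 the condition is vacuous). *)
Definition uniformly_rotund (R : realType) (X : normedModType R) : Prop :=
  forall eps : R, 0 < eps -> exists2 delta : R, 0 < delta &
    forall x y : X, `|x| = 1 -> `|y| = 1 -> eps <= `|x - y| ->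
      `|2^-1 *: (x + y)| <= 1 - delta.

(** The modulus of smoothness rho satisfies rho(t) / t --> 0 as t --> 0+. *)
Definition uniformly_smooth (R : realType) (X : normedModType R) : Prop :=
  forall eps : R, 0 < eps -> exists2 delta : R, 0 < delta &
    forall x y : X, `|x| = 1 -> `|y| <= delta ->
      `|x + y| + `|x - y| <= 2 + eps * `|y|.

Definition card_lt (T U : Type) (A : set T) (B : set U) : Prop :=
  (A #<= B) /\ ~ (B #<= A).

(** Cardinals are represented by sets: the density character of [X] is the
    cardinality of any [D] satisfying this predicate. *)
Definition is_density_character (X : topologicalType) (D : set X) : Prop :=
  dense D /\ forall D' : set X, dense D' -> D #<= D'.

(** dens(X) < 2^aleph_0, with 2^aleph_0 the cardinality of the powerset
    of [nat]. *)
Definition density_lt_continuum (X : topologicalType) : Prop :=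
  exists2 D : set X, is_density_character D & card_lt D [set: set nat].

Definition is_open_ball (R : realType) (X : normedModType R) (B : set X) :
    Prop :=
  exists (c : X) (r : R), 0 < r /\ B = ball_ Num.norm c r.

Definition is_closed_ball (R : realType) (X : normedModType R) (B : set X) :
    Prop :=
  exists (c : X) (r : R), 0 < r /\ B = closed_ball_ Num.norm c r.

Definition covering (T : Type) (F : set (set T)) : Prop :=
  \bigcup_(B in F) B = [set: T].

Definition point_finite (T : Type) (F : set (set T)) : Prop :=
  forall x : T, finite_set [set B | F B /\ B x].

(* Main.v *)
(* Call [rho - |x - c|] the depth of the point [x] in the ball of centre [c] and
   radius [rho].  Huge balls cannot accumulate at a point (uniform smoothness and
   Baire), so locally all radii are bounded.  Given a point [p] and [s > 0], one
   can move from [p] by a displacement of length about [s] that is tangent to the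
   finitely many balls containing [p] and enters all other balls only to
   an arbitrarily small depth: were the motion to get stuck, its limit point would
   lie in infinitely many balls.  By uniform rotundity the balls containing [p]
   are then left by a margin depending on [s] and on their radii only, and they
   are exited altogether if the depths at [p] were below that margin.  Iterating
   with rapidly decreasing [s] yields a convergent sequence whose limit has
   nonpositive depth in every ball; this settles coverings by open balls.  Since
   [p + w] and [p - w] can be reached simultaneously, the construction produces a
   Cantor scheme of continuum many limit points, each of which lies on the sphere
   of a closed ball of the covering, and rotundity forces these balls to be
   distinct.  Hence the covering has at least continuum many members, and by
   point-finiteness so does every dense set. *)
From mathcomp Require Import ring lra.
Require Import Defs.

Set Implicit Arguments.
Unset Strict Implicit.
Unset Printing Implicit Defensive.

Import Order.TTheory GRing.Theory Num.Theory.
Local Open Scope classical_set_scope.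
Local Open Scope ring_scope.

(** * Linear minorants of the norm and subspaces of finite codimension *)

Section Subgradient.
Variables (R : realType) (X : normedModType R).
Implicit Types (u v w : X) (t : R).

Let quot u v : set R := [set (`|u + t *: v| - `|u|) / t | t in [set t | 0 < t]].

Let quotP u v t : 0 < t -> quot u v ((`|u + t *: v| - `|u|) / t).
Proof. by exists t. Qed.

Let quot_lb u v : lbound (quot u v) (- `|v|).
Proof.
move=> _ [t /= t0 <-]; rewrite ler_pdivlMr//.
have : `|u| <= `|u + t *: v| + `|t *: v|.
  by rewrite -{1}[u](addrK (t *: v)) ler_normB.
rewrite normrZ gtr0_norm//; lra.
Qed.

Let has_inf_quot u v : has_inf (quot u v).
Proof.
by split; [eexists; exact: (@quotP u v 1)|exists (- `|v|); exact: quot_lb].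
Qed.

(* The right derivative of the norm: uniform smoothness makes it linear in [v],
   which spares the Hahn-Banach theorem. *)
Let dd u v : R := inf (quot u v).

Let ge_dd u v t : 0 < t -> dd u v * t <= `|u + t *: v| - `|u|.
Proof.
move=> t0; rewrite -ler_pdivlMr//; apply: ge_inf; last exact: quotP.
by case: (has_inf_quot u v).
Qed.

Let quot_mono u v (s t : R) : 0 < s -> s <= t ->
  (`|u + s *: v| - `|u|) / s <= (`|u + t *: v| - `|u|) / t.
Proof.
move=> s0 st; have t0 : 0 < t by lra.
have Ds : 0 < s / t by rewrite divr_gt0.
have E : u + s *: v = (1 - s / t) *: u + (s / t) *: (u + t *: v).
  rewrite scalerDr scalerA divfK ?gt_eqF// addrA -scalerDl subrK scale1r//.
have st1 : s / t <= 1 by rewrite ler_pdivrMr// mul1r.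
have H : `|u + s *: v| <= (1 - s / t) * `|u| + (s / t) * `|u + t *: v|.
  rewrite {1}E; move: (s / t) Ds st1 => a a0 a1.
  rewrite (le_trans (ler_normD _ _))// !normrZ.
  by rewrite (@ger0_norm _ (1 - a)) ?(gtr0_norm a0)//; lra.
rewrite ler_pdivrMr//.
suff -> : (`|u + t *: v| - `|u|) / t * s
  = s / t * `|u + t *: v| - s / t * `|u| by lra.
by ring.
Qed.

Let dd_near u v e : 0 < e -> exists2 t0, 0 < t0 & forall t, 0 < t -> t <= t0 ->
  `|u + t *: v| - `|u| <= (dd u v + e) * t.
Proof.
move=> e0; have [_ [t0 /= t0_gt0 <-] lt_t0] := inf_adherent e0 (has_inf_quot u v).
exists t0 => // t t_gt0 le_t; rewrite -ler_pdivrMr//.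
by have := quot_mono u v t_gt0 le_t; move: lt_t0; rewrite /dd; lra.
Qed.

Let ddD u v w : dd u (v + w) <= dd u v + dd u w.
Proof.
apply/ler_addgt0Pr => e e0; have e2 : 0 < e / 2 by lra.
have [t1 t1_gt0 H1] := dd_near u v e2.
have [t2 t2_gt0 H2] := dd_near u w e2.
pose t := Num.min t1 t2.
have t_gt0 : 0 < t by rewrite lt_min t1_gt0.
have {}H1 : `|u + t *: v| - `|u| <= (dd u v + e / 2) * t.
  by apply: H1; rewrite // ge_min lexx.
have {}H2 : `|u + t *: w| - `|u| <= (dd u w + e / 2) * t.
  by apply: H2; rewrite // ge_min lexx orbT.
have h_gt0 : 0 < t / 2 by lra.
have H := ge_dd u (v + w) h_gt0.
have E : u + (t / 2) *: (v + w) = 2^-1 *: ((u + t *: v) + (u + t *: w)).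
  have -> : (u + t *: v) + (u + t *: w) = 2 *: u + t *: (v + w).
    by rewrite addrACA -(scalerDr t) scaler_nat mulr2n.
  by rewrite [in RHS]scalerDr !scalerA mulVf ?pnatr_eq0// scale1r [_^-1 * t]mulrC.
have : `|u + (t / 2) *: (v + w)| <= 2^-1 * (`|u + t *: v| + `|u + t *: w|).
  by rewrite E normrZ ger0_norm ?invr_ge0// ler_pM2l ?invr_gt0// ler_normD.
by move=> H0; rewrite -(ler_pM2r h_gt0); lra.
Qed.

Let ddZ u v a : 0 < a -> dd u (a *: v) <= a * dd u v.
Proof.
move=> a0; apply/ler_addgt0Pr => e e0.
have ea : 0 < e / a by rewrite divr_gt0.
have [t0 t0_gt0 /(_ t0 t0_gt0 (lexx _)) H] := dd_near u v ea.
have ta : 0 < t0 / a by rewrite divr_gt0.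
have := ge_dd u (a *: v) ta; rewrite scalerA divfK ?gt_eqF// => H'.
rewrite -(ler_pM2r ta) (le_trans H')// (le_trans H)//.
rewrite le_eqVlt; apply/orP; left; apply/eqP; field; lra.
Qed.

Let ddN u v : uniformly_smooth X -> u != 0 -> dd u v + dd u (- v) <= 0.
Proof.
move=> US; rewrite -normr_gt0 => u0; apply/ler_addgt0Pr => e e0; rewrite add0r.
pose e' := e / (`|v| + 1).
have v1 : 0 < `|v| + 1 by rewrite ltr_wpDl.
have e'0 : 0 < e' by rewrite divr_gt0.
have [d d0 Hd] := US e' e'0.
(* [t] keeps the rescaled increment within [d]; the [+ 1] covers [v = 0]. *)
pose t := d * `|u| / (`|v| + 1).
have t0 : 0 < t by rewrite divr_gt0// mulr_gt0.
have x1 : `| `|u|^-1 *: u | = 1.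
  by rewrite normrZ ger0_norm ?invr_ge0// mulVf ?gt_eqF.
have normy : `|(t / `|u|) *: v| = d * (`|v| / (`|v| + 1)).
  rewrite normrZ (gtr0_norm (divr_gt0 t0 u0)) /t; field; lra.
have yd : `|(t / `|u|) *: v| <= d.
  rewrite normy ger_pMr// ler_pdivrMr//; lra.
clearbody t.
have := Hd _ _ x1 yd.
rewrite [t / _]mulrC -scalerA -scalerDr -scalerBr !normrZ.
rewrite !(ger0_norm (_ : 0 <= `|u|^-1)) ?invr_ge0//.
have := ge_dd u v t0; have := ge_dd u (- v) t0.
rewrite scalerN (gtr0_norm t0) => H1 H2.
rewrite -(ler_pM2l u0) !(mulrDr `|u|) !mulVKf ?gt_eqF// => H3.
have {}H3 : `|u + t *: v| + `|u - t *: v| - 2 * `|u| <= e' * (t * `|v|).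
  rewrite [X in _ <= X](_ : _ = `|u| * (e' * (`|u|^-1 * (t * `|v|)))); first lra.
  by field; lra.
rewrite -(ler_pM2r t0).
apply: (@le_trans _ _ (e' * (t * `|v|))); first by rewrite mulrDl; lra.
rewrite mulrCA mulrC ler_pM2r// /e' mulrAC ler_pdivrMr//; nra.
Qed.

Let dd0 u : dd u 0 = 0.
Proof.
apply/eqP; rewrite eq_le; apply/andP; split.
  by have := @ge_dd u 0 1 ltr01; rewrite scaler0 addr0 mulr1 subrr.
apply: lb_le_inf; first by eexists; exact: (@quotP u 0 1).
by move=> x /quot_lb; rewrite normr0 oppr0.
Qed.

(** For nonzero [u] take [dd u]: it is sublinear, smoothness makes it odd, hence linear, and it is
    at most the quotient at [t = 1]. *)
Lemma ex_subgradient u : uniformly_smooth X ->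
  exists g : X -> R, scalar g /\ forall v, `|u| + g v <= `|u + v|.
Proof.
move=> US; have [->|u0] := eqVneq u 0.
  exists (fun=> 0); split=> [a v w|v]; first by rewrite mulr0 addr0.
  by rewrite normr0 add0r.
have EN v : dd u (- v) = - dd u v.
  apply/eqP; rewrite eq_le; apply/andP; split.
    by have := ddN v US u0; lra.
  by have := ddD u v (- v); rewrite subrr dd0; lra.
have ED v w : dd u (v + w) = dd u v + dd u w.
  apply/eqP; rewrite eq_le ddD /=.
  by have := ddD u (v + w) (- w); rewrite addrK EN; lra.
have EZ a v : 0 < a -> dd u (a *: v) = a * dd u v.
  move=> a0; apply/eqP; rewrite eq_le ddZ //=.
  have ai : 0 < a^-1 by rewrite invr_gt0.
  have := @ddZ u (a *: v) a^-1 ai; rewrite scalerA mulVf ?gt_eqF// scale1r.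
  by rewrite -(ler_pM2l a0) mulVKf ?gt_eqF.
exists (dd u); split=> [a v w|v]; last first.
  by have := @ge_dd u v 1 ltr01; rewrite scale1r mulr1; lra.
rewrite ED; congr (_ + _).
have [a0|a0|->] := ltrgtP a 0; first 1 last.
- exact: EZ.
- by rewrite scale0r dd0 mul0r.
- by rewrite -[a *: v]opprK -scaleNr EN EZ ?oppr_gt0// mulNr opprK.
Qed.

End Subgradient.

(** * Subspaces of finite codimension *)

Section FiniteCodimension.
Variables (R : realType) (X : lmodType R).
Implicit Types (V W : set X) (v w : X).

Definition finite_codim V := (V 0 /\ forall a v w, V v -> V w -> V (a *: v + w))
  /\ exists n (e : 'I_n -> X), forall x, exists c : 'I_n -> R,
       V (x - \sum_(i < n) c i *: e i).

Lemma finite_codimD V v w : finite_codim V -> V v -> V w -> V (v + w).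
Proof. by move=> [[_ VD] _] Vv Vw; rewrite -[v]scale1r; exact: VD. Qed.

Lemma finite_codimZ V a v : finite_codim V -> V v -> V (a *: v).
Proof. by move=> [[V0 VD] _] Vv; rewrite -[_ *: _]addr0; exact: VD. Qed.

Lemma finite_codimN V v : finite_codim V -> V v -> V (- v).
Proof. by move=> fV; rewrite -scaleN1r; exact: finite_codimZ. Qed.

Lemma finite_codimT : finite_codim setT.
Proof. by split=> //; exists 0, (fun=> 0) => x; exists (fun=> 0). Qed.

Lemma finite_codim_ker V (g : X -> R) : scalar g -> finite_codim V ->
  finite_codim (V `&` [set v | g v = 0]).
Proof.
move=> lg fV; have [[V0 VD] [n [e eP]]] := fV.
have g0 : g 0 = 0 by have := lg (-1) 0 0; rewrite scaler0 addr0; lra.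
have gZ a v : g (a *: v) = a * g v by rewrite -[_ *: _]addr0 lg g0 addr0.
split.
  split=> [//|a v w [Vv gv] [Vw gw]]; split; first exact: VD.
  by rewrite /= lg gv gw mulr0 addr0.
have [gV|] := pselect (forall v, V v -> g v = 0).
  by exists n, e => x; have [c Vc] := eP x; exists c; split=> //=; exact: gV.
move=> /existsNP[v0 /not_implyP[Vv0 /eqP gv0]].
(* The extra vector [v0] absorbs the value of [g] on the remainder [y]. *)
exists n.+1, (fun i => if unlift ord0 i is Some j then e j else v0) => x.
have [c Vc] := eP x; set y := x - _ in Vc.
exists (fun i => if unlift ord0 i is Some j then c j else g y / g v0).
rewrite big_ord_recl unlift_none.
under eq_bigr do rewrite liftK.
rewrite opprD addrCA -/y addrC -scaleNr addrC; split; first exact: VD.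
by rewrite /= lg mulNr divfK// addNr.
Qed.

Lemma finite_codim_kers (I : choiceType) (A : set I) (g : I -> X -> R) V :
  finite_set A -> (forall i, scalar (g i)) -> finite_codim V ->
  finite_codim (V `&` [set v | forall i, A i -> g i v = 0]).
Proof.
move=> /finite_seqP[s ->] lg; elim: s V => [|i s IH] V fV.
  suff -> : [set v | forall i, [set` [::]] i -> g i v = 0] = setT by rewrite setIT.
  by apply/seteqP; split.
have := IH _ (finite_codim_ker (lg i) fV); rewrite -setIA.
congr (finite_codim (V `&` _)); apply/seteqP; split=> v /=.
  by case=> gi gs j; rewrite inE => /predU1P[->//|/gs].
by move=> gs; split=> [|j js]; apply: gs; rewrite inE ?eqxx ?js ?orbT.
Qed.

Lemma finite_codim_nonzero V : infinite_dimensional X -> finite_codim V ->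
  exists2 v, V v & v != 0.
Proof.
move=> Xoo [_ [n [e eP]]]; apply: contrapT => noV; apply: (Xoo n e) => x.
have [c Vc] := eP x; exists c; apply/eqP; rewrite -subr_eq0.
by apply/negPn/negP => nz; apply: noV; exists (x - \sum_(i < n) c i *: e i).
Qed.

End FiniteCodimension.

(** * Uniform rotundity *)

Section ConvexityGap.
Variables (R : realType) (X : normedModType R).
Implicit Types (a b u v : X) (D s g r : R).

(** Rotundity at all radii up to [D] at once, with an absolute loss [g]. *)
Definition midpoint_gap D s g := forall r a b, r <= D ->
  `|a| <= r -> `|b| <= r -> s <= `|a - b| -> `|2^-1 *: (a + b)| <= r - g.

(* Being a supremum, the gap is monotone in [D]. *)
Definition convexity_gap D s : R :=
  sup [set g | [/\ 0 <= g, g <= 1, g <= s & midpoint_gap D s g]].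

Let gaps_ubound D s :
  has_ubound [set g | [/\ 0 <= g, g <= 1, g <= s & midpoint_gap D s g]].
Proof. by exists 1 => g []. Qed.

Let gaps0 D s : 0 <= s -> [/\ (0 : R) <= 0, (0 : R) <= 1, 0 <= s & midpoint_gap D s 0].
Proof.
move=> s0; split => // r a b _ ar br _; rewrite normrZ ger0_norm ?invr_ge0//.
by have := ler_normD a b; lra.
Qed.

Lemma convexity_gap_le1 D s : 0 <= s -> convexity_gap D s <= 1.
Proof. by move=> s0; apply: ge_sup => [|g []//]; exists 0; exact: gaps0. Qed.

Lemma convexity_gap_le D s : 0 <= s -> convexity_gap D s <= s.
Proof. by move=> s0; apply: ge_sup => [|g []//]; exists 0; exact: gaps0. Qed.

Lemma convexity_gapP D s : 0 <= s -> midpoint_gap D s (convexity_gap D s).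
Proof.
move=> s0 r a b rD ar br sab; rewrite lerBrDr addrC -lerBrDr.
apply: ge_sup => [|g [_ _ _ /(_ r a b rD ar br sab)]]; last lra.
by exists 0; exact: gaps0.
Qed.

Lemma le_convexity_gap D D' s : 0 <= s -> D <= D' ->
  convexity_gap D' s <= convexity_gap D s.
Proof.
move=> s0 DD'; apply: ge_sup => [|g [g0 g1 gs gP]]; first by exists 0; exact: gaps0.
apply: ub_le_sup => //; split=> // r a b rD; apply: gP; exact: le_trans rD DD'.
Qed.

(** If the midpoint had norm above [r - g], both points would have norm above [r - 2 * g];
    projecting them radially to the unit sphere then contradicts Clarkson's condition. *)
Lemma convexity_gap_gt0 D s : uniformly_rotund X -> 0 < s ->
  0 < convexity_gap D s.
Proof.
move=> UR s0; have [D0|D0] := leP D 0.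
  apply: (@lt_le_trans _ _ (Num.min 1 s)); first by rewrite lt_min ltr01.
  apply: ub_le_sup => //; split; rewrite ?le_min ?ge_min ?lexx ?ler01 ?(ltW s0) ?orbT//.
  move=> r a b rD ar br; have := ler_normB a b; have := normr_ge0 a; lra.
have e0 : 0 < s / (2 * D) by rewrite divr_gt0// mulr_gt0.
have [d d0 dP] := UR _ e0.
(* [s / 8] keeps the projections, rescaled by [r], at least [s / 2] apart; [s * d / 6] makes the
   loss [r * d] at least the total error [3 * g]. *)
pose g := Num.min (Num.min 1 (s / 8)) (s * d / 6).
have [g1 gs gd] : [/\ g <= 1, g <= s / 8 & g <= s * d / 6].
  by split; rewrite /g !ge_min lexx ?orbT.
have g0 : 0 < g by rewrite !lt_min ltr01 !divr_gt0// mulr_gt0.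
clearbody g; apply: (lt_le_trans g0); apply: ub_le_sup => //.
split=> //; [lra|lra|] => r a b rD ar br sab.
rewrite leNgt; apply/negP => gap.
have r0 : s / 2 <= r by have := ler_normB a b; lra.
have [Ha Hb] : r - 2 * g < `|a| /\ r - 2 * g < `|b|.
  move: gap; rewrite normrZ ger0_norm ?invr_ge0//; have := ler_normD a b; split; lra.
have [a0 b0] : 0 < `|a| /\ 0 < `|b| by split; lra.
pose a' := `|a|^-1 *: a; pose b' := `|b|^-1 *: b.
have unit u : 0 < `|u| -> `| `|u|^-1 *: u | = 1.
  by move=> u0; rewrite normrZ ger0_norm ?invr_ge0// mulVf ?gt_eqF.
have near u : 0 < `|u| -> `|u| <= r -> `|r *: (`|u|^-1 *: u) - u| <= r - `|u|.
  move=> u0 ur; rewrite -[X in _ - X](@scalerKV _ _ `|u|) ?unitfE ?gt_eqF//.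
  by rewrite -scalerBl normrZ unit// mulr1 ger0_norm// subr_ge0.
have {near}[na nb] := (near a a0 ar, near b b0 br).
have a'1 : `|a'| = 1 by exact: unit.
have b'1 : `|b'| = 1 by exact: unit.
rewrite -/a' -/b' in na nb; clearbody a' b'.
have rr : 0 < r by lra.
have Hd : s / (2 * D) <= `|a' - b'|.
  have : s / 2 <= r * `|a' - b'|.
    have -> : r * `|a' - b'| = `|r *: (a' - b')| by rewrite normrZ gtr0_norm.
    rewrite scalerBr.
    have -> : r *: a' - r *: b' = (a - b) + ((r *: a' - a) - (r *: b' - b)).
      by rewrite opprB addrACA addKr addrCA subrr addr0.
    have := ler_normB (r *: a' - a) (r *: b' - b).
    have := lerB_normD (a - b) ((r *: a' - a) - (r *: b' - b)); lra.
  move=> H; rewrite ler_pdivrMr ?mulr_gt0//.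
  have := ler_wpM2r (normr_ge0 (a' - b')) rD; lra.
have := dP _ _ a'1 b'1 Hd.
rewrite -(ler_pM2l rr).
have -> : r * `|2^-1 *: (a' + b')| = `|r *: (2^-1 *: (a' + b'))|.
  by rewrite [RHS]normrZ gtr0_norm.
have -> : r *: (2^-1 *: (a' + b')) =
    2^-1 *: (a + b) + 2^-1 *: ((r *: a' - a) + (r *: b' - b)).
  rewrite scalerA mulrC -scalerA [r *: _]scalerDr -[RHS]scalerDr; congr (_ *: _).
  by rewrite (addrACA (r *: a')) -opprD [RHS]addrC subrK.
have := lerB_normD (2^-1 *: (a + b)) (2^-1 *: ((r *: a' - a) + (r *: b' - b))).
have : `|2^-1 *: ((r *: a' - a) + (r *: b' - b))| <= 2 * g.
  rewrite normrZ ger0_norm ?invr_ge0//.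
  have := ler_normD (r *: a' - a) (r *: b' - b); lra.
have : s * d / 2 <= r * d by rewrite mulrAC ler_pM2r.
lra.
Qed.

(** Otherwise [u] and [u + v] lie in the ball of radius [|u + v|] about 0, and their midpoint would
    be shorter than [u]. As gaps are at most 1, that radius is below [D + 1]. *)
Lemma convexity_gap_gain D s u v : 0 <= s ->
  `|u| <= D -> s <= `|v| -> `|u| <= `|u + 2^-1 *: v| ->
  `|u| + convexity_gap (D + 1) s <= `|u + v|.
Proof.
move=> s0 uD sv uv; rewrite leNgt; apply/negP => lt_gap.
have g1 := convexity_gap_le1 (D + 1) s0.
have E : u + 2^-1 *: v = 2^-1 *: (u + (u + v)).
  have -> : u + (u + v) = 2 *: u + v by rewrite addrA scaler_nat mulr2n.
  by rewrite scalerDr scalerA mulVf ?pnatr_eq0// scale1r.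
have uv1 : `|u| <= `|u + v|.
  move: uv; rewrite E normrZ ger0_norm ?invr_ge0//.
  have := ler_normD u (u + v); lra.
have := @convexity_gapP (D + 1) s s0 `|u + v| u (u + v).
rewrite opprD addrA subrr add0r normrN lexx -E => /(_ _ uv1 isT sv).
have uvD : `|u + v| <= D + 1 by lra.
move=> /(_ uvD); lra.
Qed.

End ConvexityGap.

(** * Local boundedness of the radii *)

Lemma cauchy_norm_cvg (R : realType) (X : completeNormedModType R) (u : nat -> X) :
  (forall e, 0 < e -> exists N, forall n, (N <= n)%N -> `|u n - u N| < e) ->
  exists l, forall e, 0 < e ->
    exists N, forall n, (N <= n)%N -> `|u n - l| < e.
Proof.
move=> Cu; have cu : cauchy (u @ \oo).
  apply: cauchy_exP => e e0; have [N NP] := Cu e e0.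
  exists (u N); exists N => //= n Nn.
  by rewrite -ball_normE /ball_ /= distrC; exact: NP.
have /cauchy_cvgP/cvg_ex[l ul] := cu.
exists l => e e0; move/cvgrPdist_lt: ul => /(_ e e0)[N _ NP].
by exists N => n Nn; rewrite distrC; exact: NP.
Qed.

Section BoundedRadii.
Variables (R : realType) (X : completeNormedModType R).
Variables (I : Type) (c : I -> X) (rho : I -> R).
Hypothesis US : uniformly_smooth X.
Hypothesis pf : forall x, finite_set [set i | `|x - c i| < rho i].

(* Huge balls coming near [z] are nearly half-spaces; were there infinitely
   many of them, then, as no point is covered infinitely often, uniform
   smoothness would put every point at distance tending to 0 from them,
   and Baire's theorem would yield a point lying in infinitely many of them. *)
Lemma locally_bounded_radii z : exists e M : R, 0 < e /\
  forall i, `|z - c i| < rho i + e -> rho i <= M.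
Proof.
apply: contrapT => unb.
have /choice[i iP] (n : nat) : exists i : I,
    `|z - c i| < rho i + n.+1%:R^-1 /\ n%:R < rho i.
  apply: contrapT => H; apply: unb; exists n.+1%:R^-1, n%:R.
  split=> [|j jz]; first by rewrite invr_gt0.
  by rewrite leNgt; apply/negP => jn; apply: H; exists j.
(* The finitely many balls containing [y] have bounded radii, whereas [rho (i n)] exceeds [n]. *)
have far y : exists N, forall n, (N <= n)%N -> rho (i n) <= `|y - c (i n)|.
  have [M MP] : exists M : nat, forall j, `|y - c j| < rho j -> rho j <= M%:R.
    have /finite_seqP[A AE] := finite_image rho (pf y).
    exists (Num.truncn (\sum_(r <- A) `|r|)).+1 => j jy.
    have rA : rho j \in A.
      by have : [set` A] (rho j) by rewrite -AE; exists j.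
    apply: le_trans (ltW (truncnS_gt _)).
    rewrite (big_rem (rho j))//= (le_trans (ler_norm _))// lerDl.
    by rewrite sumr_ge0.
  exists M => n Mn; rewrite leNgt; apply/negP => /MP.
  have := (iP n).2; have : (M%:R : R) <= n%:R by rewrite ler_nat.
  by lra.
pose O N := \bigcup_(n in [set n | (N <= n)%N]) ball (c (i n)) (rho (i n)).
have oO N : open (O N).
  by apply: bigcup_open => n _; exact: ball_open.
have dO N : dense (O N).
  move=> U [y Uy] oU.
  have /nbhs_ballP[e /= e0 eU] : nbhs y U by apply: open_nbhs_nbhs.
  have w1 : 0 < `|y - z| + 1 by rewrite ltr_wpDl.
  pose eta := e / 4 / (`|y - z| + 1).
  have eta0 : 0 < eta by rewrite !divr_gt0.
  have [d d0 dP] := US eta0.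
  (* The reflection [z - (y - z)] of [y] is outside the ball and [z] is almost inside, so smoothness
     brings [y] within [e / 2] of the ball. *)
  have [N1 N1P] := far z; have [N2 N2P] := far (z - (y - z)).
  have [N3 N3P] := far y.
  (* The summands allow the smoothness estimate, a shift by [e / 2] short of the centre, and
     [n.+1%:R^-1 <= e / 8]. *)
  have [k kP] : exists k : nat, (`|y - z| / d + e + 8 / e) < k%:R.
    by exists (Num.truncn (`|y - z| / d + e + 8 / e)).+1; exact: truncnS_gt.
  pose n := maxn (maxn N k) (maxn N1 (maxn N2 N3)).
  have [nN nk n1 n2 n3] : [/\ (N <= n)%N, (k <= n)%N, (N1 <= n)%N, (N2 <= n)%N & (N3 <= n)%N].
    by rewrite /n !leq_max !leqnn ?orbT.
  have [in1 in2] := iP n; clearbody n.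
  have {}nk : (k%:R : R) <= n%:R by rewrite ler_nat.
  have {}n1 := N1P n n1; have {}n2 := N2P n n2; have {}n3 := N3P n n3.
  have yd0 : 0 <= `|y - z| / d by rewrite divr_ge0 ?(ltW d0).
  have e80 : 0 < 8 / e by rewrite divr_gt0.
  have [C CE] : exists C, C = c (i n) by eexists.
  have [r rE] : exists r, r = rho (i n) by eexists.
  rewrite -CE -?rE in in1 in2 n1 n2 n3.
  have zC : 0 < `|z - C| by lra.
  have invn : n.+1%:R^-1 <= e / 8.
    rewrite -[leRHS]invrK lef_pV2 ?posrE ?invr_gt0 ?divr_gt0// invf_div.
    by rewrite -natr1; lra.
  have u1 : `| `|z - C|^-1 *: (z - C) | = 1.
    by rewrite normrZ ger0_norm ?invr_ge0// mulVf ?gt_eqF.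
  have wd : `| `|z - C|^-1 *: (y - z) | <= d.
    rewrite normrZ ger0_norm ?invr_ge0// mulrC ler_pdivrMr//.
    rewrite mulrC -ler_pdivrMr//; lra.
  have := dP _ _ u1 wd; rewrite -scalerDr -scalerBr !normrZ.
  rewrite !(ger0_norm (_ : 0 <= `|z - C|^-1)) ?invr_ge0//.
  rewrite -(ler_pM2l zC) !mulrDr !mulVKf ?gt_eqF//.
  rewrite [`|_| * (eta * _)]mulrCA mulVKf ?gt_eqF// => smooth.
  have {}smooth : `|y - C| < r + e / 2.
    have E1 : z - C + (y - z) = y - C by rewrite addrC addrA subrK.
    have E2 : z - C - (y - z) = z - (y - z) - C by rewrite addrAC.
    rewrite E1 E2 in smooth.
    have : eta * `|y - z| <= e / 4.
      by rewrite /eta mulrAC ler_pdivrMr// ler_pM2l ?divr_gt0//; lra.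
    clearbody eta; move: smooth invn in1 n2; rewrite !mulr1. move: (n.+1%:R^-1) (z - (y - z) - C) => q B; lra.
  have yC : 0 < `|y - C| by lra.
  exists (y + (e / 2 / `|y - C|) *: (C - y)); split; last first.
    exists n => //; rewrite -ball_normE /ball_ /= -CE -rE.
    have -> : C - (y + (e / 2 / `|y - C|) *: (C - y)) =
        (1 - e / 2 / `|y - C|) *: (C - y).
      by rewrite scalerBl scale1r opprD addrA.
    rewrite normrZ ger0_norm; last first.
      by rewrite subr_ge0 ler_pdivrMr// mul1r; lra.
    rewrite (distrC C y) mulrBl mul1r divfK ?gt_eqF//; lra.
  apply: eU; rewrite -ball_normE /ball_ /= opprD addrA subrr add0r normrN.
  rewrite normrZ gtr0_norm ?divr_gt0// (distrC C y) divfK ?gt_eqF//; lra.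
have [|y [_ yO]] := Baire (fun N => conj (oO N) (dO N)) _ (@openT X).
  by exists 0.
have [N NP] := far y; have [n /= Nn] := yO N Logic.I.
rewrite -ball_normE /ball_ /= distrC => yn.
by have := NP n Nn; lra.
Qed.

End BoundedRadii.

(** * Shallow displacements and the Cantor scheme *)

Lemma guarded_dependent_choice (T : Type) (P : T -> Prop) (Q : T -> T -> Prop) x0 :
  P x0 -> (forall x, P x -> exists y, P y /\ Q x y) ->
  exists f : nat -> T, forall n, P (f n) /\ Q (f n) (f n.+1).
Proof.
move=> Px0 PQ; have /choice[g gP] x : exists y, P x -> P y /\ Q x y.
  by have [/PQ[y]|] := pselect (P x); [exists y|exists x].
have Pf n : P (iter n g x0) by elim: n => //= n /gP[].
by exists (fun n => iter n g x0) => n; split=> //; case: (gP _ (Pf n)).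
Qed.

Section BallFamily.
Variables (R : realType) (X : completeNormedModType R).
Variables (I : choiceType) (c : I -> X) (rho : I -> R).
Hypothesis Xoo : infinite_dimensional X.
Hypothesis UR : uniformly_rotund X.
Hypothesis US : uniformly_smooth X.
Implicit Types (x v w p : X) (V W : set X) (i : I).

Definition depth i x : R := rho i - `|x - c i|.

Hypothesis pf : forall x, finite_set [set i | 0 < depth i x].

Lemma depth_lip i x v : depth i x - `|v| <= depth i (x + v) <= depth i x + `|v|.
Proof.
rewrite /depth; have E : x + v - c i = (x - c i) + v by rewrite addrAC.
have H1 := ler_normD (x - c i) v.
have H2 := lerB_normD (x - c i) v.
by rewrite E; apply/andP; split; lra.
Qed.

(** [W] is the common kernel in [V] of subgradients of the norm at the points [y j]. *)
Lemma tangent_space (J : choiceType) (A : set J) (y : J -> X) V :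
  finite_set A -> finite_codim V -> exists W, [/\ finite_codim W, W `<=` V &
    forall j v, A j -> W v -> `|y j| <= `|y j + v|].
Proof.
move=> fA fV; have /choice[g gP] j := ex_subgradient (y j) US.
exists (V `&` [set v | forall j, A j -> g j v = 0]); split.
- by apply: finite_codim_kers => // j; case: (gP j).
- by move=> v [].
- by move=> j v Aj [_ gv]; have [_ /(_ v)] := gP j; rewrite gv// addr0.
Qed.

(** * Greedy displacements of prescribed length *)

Section Block.
Variables (p : X) (V0 : set X) (t : I -> R) (s : R).
Hypothesis fV0 : finite_codim V0.
Hypothesis s0 : 0 < s.
Hypothesis t0 : forall i, 0 < t i.
(** Thresholds of the balls near a point stay away from 0, so some step length is always
    admissible. *)
Hypothesis tloc : forall x, exists e : R, 0 < e /\
  forall i, - e < depth i x -> e < t i.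

Let shallow w := forall i, depth i p <= 0 ->
  depth i (p + w) < t i /\ depth i (p - w) < t i.

(** A step of length [e] from [p + w] or [p - w] can newly enter only balls whose threshold exceeds
    [e]; [e <= s] prevents overshooting [2 * s]. *)
Let adm e w := [/\ 0 < e, e <= s &
  forall i, - e < depth i (p + w) \/ - e < depth i (p - w) -> e < t i].

Let adm_ex w : exists e, adm e w.
Proof.
have [e1 [e10 H1]] := tloc (p + w); have [e2 [e20 H2]] := tloc (p - w).
pose e := Num.min s (Num.min e1 e2).
have [es ee1 ee2] : [/\ e <= s, e <= e1 & e <= e2].
  by split; rewrite !ge_min lexx ?orbT.
exists e; split=> // [|i []]; first by rewrite !lt_min s0 e10 e20.
- by move=> H; apply: (le_lt_trans ee1); apply: H1; lra.
- by move=> H; apply: (le_lt_trans ee2); apply: H2; lra.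
Qed.

(** The supremum need not be attained, so a greedy step settles for half of it. *)
Let adm_sup w : exists e, adm e w /\ forall e', adm e' w -> e' <= 2 * e.
Proof.
pose E := [set e | adm e w].
have supE : has_sup E by split; [exact: adm_ex|exists s => e []].
have S0 : 0 < sup E.
  have [e ae] := adm_ex w; have [e0 _ _] := ae.
  by apply: lt_le_trans e0 _; apply: ub_le_sup => //; case: supE.
have S2 : 0 < sup E / 2 by lra.
have [e ae lte] := sup_adherent S2 supE.
exists e; split=> // e' ae'.
have : e' <= sup E by apply: ub_le_sup => //; case: supE.
by lra.
Qed.

(** Tangency handles balls containing [x]; those within [e] are entered by less than their
    threshold; the rest stay unentered. *)
Let step_shift i x v e : 0 < e -> `|v| = e -> (- e < depth i x -> e < t i) ->
  depth i x < t i -> (0 < depth i x -> `|x - c i| <= `|x - c i + v|) ->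
  depth i (x + v) < t i.
Proof.
move=> e0 ve et dt tan; have /andP[_ H] := depth_lip i x v.
have ti := t0 i; have [d0|d0] := ltP 0 (depth i x).
  have := tan d0; rewrite /depth in dt *.
  have -> : x + v - c i = (x - c i) + v by rewrite addrAC.
  lra.
have [/et|] := ltP (- e) (depth i x); lra.
Qed.

Let inv (q : X * set X) :=
  [/\ finite_codim q.2, q.2 `<=` V0, V0 q.1, `|q.1| < s & shallow q.1].

Let next (q q' : X * set X) := [/\ q'.2 `<=` q.2, q'.2 (q'.1 - q.1),
  forall v, q'.2 v -> `|q.1| <= `|q.1 + v| &
  forall e, adm e q.1 -> e <= 2 * `|q'.1 - q.1| ].

(** The direction is tangent to the balls containing [p + w] or [p - w] and to the sphere about 0
    through [w]. A step reaching norm [s] would contradict [stuck]. *)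
Let step q : ~ (exists w, [/\ V0 w, s <= `|w|, `|w| <= 2 * s & shallow w]) ->
  inv q -> exists q', inv q' /\ next q q'.
Proof.
move=> stuck; case: q => w V [/= fV VV0 V0w ws shw].
have [e [[e0 es eP] emax]] := adm_sup w.
have [W1 [fW1 W1V H1]] := tangent_space (fun i => p + w - c i) (pf (p + w)) fV.
have [W2 [fW2 W2W H2]] := tangent_space (fun i => p - w - c i) (pf (p - w)) fW1.
have [W [fW WW2 H3]] := tangent_space (fun=> w) (@finite_finset unit setT) fW2.
have WV : W `<=` V by move=> v /WW2/W2W/W1V.
have [v Wv v0] := finite_codim_nonzero Xoo fW.
have nv : 0 < `|v| by rewrite normr_gt0.
pose u := (e / `|v|) *: v.
have Wu : W u by exact: finite_codimZ.
have nu : `|u| = e by rewrite /u normrZ gtr0_norm ?divr_gt0// divfK ?gt_eqF.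
clearbody u.
have V0u : V0 (w + u) by apply: finite_codimD => //; exact/VV0/WV.
have shu : shallow (w + u).
  move=> i ip; have [c1 c2] := shw i ip; split.
    rewrite addrA; apply: (step_shift e0 nu) => //; first by move=> h; apply: eP; left.
    by move=> h; apply: H1 => //; exact/W2W/WW2.
  rewrite opprD addrA; apply: (step_shift e0) => //; first by rewrite normrN.
    by move=> h; apply: eP; right.
  by move=> h; apply: H2 => //; apply/WW2; exact: finite_codimN.
have wus : `|w + u| < s.
  rewrite ltNge; apply/negP => wu; apply: stuck; exists (w + u); split=> //.
  by have := ler_normD w u; lra.
exists (w + u, W); split; split=> //=.
- exact: subset_trans WV VV0.
- by rewrite addrC addKr.
- by move=> x Wx; exact: (H3 tt).
- by move=> e' /emax; rewrite (addrC w) addrK nu.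
Qed.

(* A greedy path: each step is tangent to all balls met so far, hence never
   enters them deeper, and keeps the norm nondecreasing; so if the path stayed
   in a bounded region it would converge by uniform rotundity, although near its
   limit steps of a fixed length remain admissible. *)
Lemma shallow_displacement : exists w, [/\ V0 w, s <= `|w|, `|w| <= 2 * s &
  forall i, depth i p <= 0 -> depth i (p + w) < t i /\ depth i (p - w) < t i].
Proof.
apply: contrapT => stuck.
have inv0 : inv (0, V0).
  split=> //=; rewrite ?normr0//; first by have [[]] := fV0.
  by move=> i ip; rewrite subr0 addr0; split; apply: le_lt_trans ip (t0 i).
have [q qP] := guarded_dependent_choice inv0 (fun _ => step stuck).
pose w n := (q n).1; pose V n := (q n).2.
have dV n k : V (n + k)%N `<=` V n.
  elim: k => [|k IH]; first by rewrite addn0.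
  by rewrite addnS; apply: subset_trans IH; case: (qP (n + k)%N) => _ [].
have wV n k : V n.+1 (w (n + k)%N - w n).
  have [[fV _ _ _ _] _] := qP n.+1.
  elim: k => [|k IH]; first by rewrite addn0 subrr; case: fV => [[]].
  rewrite addnS -(subrK (w (n + k)%N) (w _.+1)) -addrA.
  apply: finite_codimD => //; case: (qP (n + k)%N) => _ [_ + _ _].
  by rewrite -addSn; exact: (@dV n.+1 k).
have ws n : `|w n| < s by case: (qP n) => -[].
have tan n v : V n.+1 v -> `|w n| <= `|w n + v| by case: (qP n) => _ [_ _ + _]; exact.
have gain n k d : 0 < d -> d <= `|w (n + k)%N - w n| ->
    `|w n| + convexity_gap X (s + 1) d <= `|w (n + k)%N|.
  move=> d0 dw; rewrite -(subrK (w n) (w (n + k)%N)) [X in _ <= `|X|]addrC.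
  apply: convexity_gap_gain => //; [exact: ltW|exact: ltW|].
  by apply: tan; apply: finite_codimZ => //; case: (qP n.+1) => -[].
have mono n k : `|w n| <= `|w (n + k)%N|.
  by have := tan n _ (wV n k); rewrite addrC subrK.
have cau e : 0 < e -> exists N, forall n, (N <= n)%N -> `|w n - w N| < e.
  move=> e0; have g0 := convexity_gap_gt0 (s + 1) UR e0.
  pose E := range (fun n => `|w n|).
  have supE : has_sup E.
    by split; [exists `|w 0%N|; exists 0%N|exists s => _ [n _ <-]; exact: ltW].
  (* Past [N] the norms gain less than the gap, so no displacement of length [e] is left. *)
  have [_ [N _ <-] HN] := sup_adherent g0 supE.
  exists N => n Nn; rewrite ltNge; apply/negP => en.
  rewrite -(subnKC Nn) in en.
  have := gain _ _ _ e0 en.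
  have : `|w (N + (n - N))%N| <= sup E.
    by apply: ub_le_sup; [case: supE|exists (N + (n - N))%N].
  by lra.
have [l lP] := cauchy_norm_cvg cau.
have [e [e0 es eP]] := adm_ex l.
have e80 : 0 < e / 8 by lra.
have [N NP] := lP _ e80.
have H0 := NP N (leqnn _); have H1 := NP N.+1 (leqnSn _).
(* Being admissible at [w N], [e / 2] forces a step of length at least [e / 4] there, yet both its
   ends are closer than [e / 8] to [l]. *)
have admN : adm (e / 2) (w N).
  split; [lra|lra|] => i H; suff : e < t i by lra.
  have H0' : `|l - w N| < e / 8 by rewrite distrC.
  apply: eP; case: H => H; [left|right].
    have /andP[+ _] := depth_lip i (p + w N) (l - w N).
    have -> : p + w N + (l - w N) = p + l by rewrite -addrA [w N + _]addrC subrK.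
    by lra.
  have /andP[+ _] := depth_lip i (p - w N) (w N - l).
  have -> : p - w N + (w N - l) = p - l by rewrite addrA subrK.
  by lra.
have [_ [_ _ _ /(_ _ admN)]] := qP N.
rewrite -/(w N) -/(w N.+1).
have : `|w N.+1 - w N| <= `|w N.+1 - l| + `|w N - l|.
  by rewrite (distrC (w N)) -[X in `|X|](subrKA l) ler_normD.
by lra.
Qed.

End Block.

(** * The binary tree of displacements *)

Implicit Types (a b : nat -> bool).

(** Half the gap: a depth below [tol s i] that drops by the whole gap ends below [- tol s i]. The
    [+ 1] comes from [convexity_gap_gain]. *)
Let tol s i : R := convexity_gap X (rho i + 1) s / 2.

Let tol_gt0 s i : 0 < s -> 0 < tol s i.
Proof. by move=> s0; rewrite divr_gt0// convexity_gap_gt0. Qed.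

Let radii x : exists e M : R, 0 < e /\ forall i, - e < depth i x -> rho i <= M.
Proof.
have [y|e [M [e0 H]]] := @locally_bounded_radii _ _ _ c rho US _ x.
  by apply: sub_finite_set (pf y) => i /=; rewrite /depth subr_gt0.
exists e, M; split=> // i ie; apply: H; move: ie; rewrite /depth; lra.
Qed.

Let tol_loc s x : 0 < s -> exists e : R, 0 < e /\
  forall i, - e < depth i x -> e < tol s i.
Proof.
move=> s0; have [e1 [M [e10 H]]] := radii x.
have g0 := convexity_gap_gt0 (M + 1) UR s0.
pose e := Num.min e1 (convexity_gap X (M + 1) s / 4).
have [ee eg] : e <= e1 /\ e <= convexity_gap X (M + 1) s / 4.
  by split; rewrite !ge_min lexx ?orbT.
exists e; split=> [|i ie]; first by rewrite lt_min e10 divr_gt0.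
have iM : rho i + 1 <= M + 1 by rewrite lerD2r; apply: H; lra.
by have := le_convexity_gap X (ltW s0) iM; rewrite /tol; lra.
Qed.

(** [w] is tangent to the balls containing [p], so rotundity drives [p + w] and [p - w] out of them;
    [shallow_displacement] handles the others. *)
Let branching s s' p : 0 < s -> 0 < s' -> (forall i, depth i p < tol s i) ->
  exists w, [/\ s <= `|w|, `|w| <= 2 * s,
    forall i, depth i (p + w) < tol s' i /\ depth i (p - w) < tol s' i &
    forall i, 0 < depth i p ->
      depth i (p + w) <= - tol s i /\ depth i (p - w) <= - tol s i].
Proof.
move=> s0 s'0 ptol.
have [V [fV _ tanV]] :=
  tangent_space (fun i => p - c i) (pf p) (finite_codimT X).
have [w [Vw sw ws shw]] := shallow_displacement p fV s0
  (fun i => tol_gt0 i s'0) (fun x => tol_loc x s'0).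
have exit i v : V v -> s <= `|v| -> 0 < depth i p -> depth i (p + v) <= - tol s i.
  move=> Vv sv ip; have V2v : V (2^-1 *: v) by exact: finite_codimZ.
  have pD : `|p - c i| <= rho i by move: ip; rewrite /depth; lra.
  have := convexity_gap_gain (ltW s0) pD sv (tanV _ _ ip V2v).
  have := ptol i; rewrite /tol /depth.
  have -> : p + v - c i = (p - c i) + v by rewrite addrAC.
  by lra.
have exits i : 0 < depth i p ->
    depth i (p + w) <= - tol s i /\ depth i (p - w) <= - tol s i.
  move=> ip; split; apply: exit => //; first exact: finite_codimN.
  by rewrite normrN.
exists w; split=> // i; have [ip|/shw//] := ltP 0 (depth i p).
have := tol_gt0 i s0; have := tol_gt0 i s'0; have [] := exits i ip.
by split; lra.
Qed.

(** From 0, move by at least twice the radius of every ball containing 0. *)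
Let root : exists p, forall i, depth i p < tol 1 i.
Proof.
have [r [r0 rP]] : exists r : R, 0 < r /\ forall i, 0 < depth i 0 -> 2 * rho i <= r.
  have /finite_seqP[A AE] := finite_image rho (pf 0).
  exists (2 * (\sum_(r <- A) `|r|) + 1); split=> [|i i0].
    by rewrite ltr_wpDl// mulr_ge0// sumr_ge0.
  have rA : rho i \in A by have : [set` A] (rho i) by rewrite -AE; exists i.
  rewrite (big_rem (rho i))//=.
  have := ler_norm (rho i).
  have : 0 <= \sum_(y <- rem (rho i) A) `|y| by rewrite sumr_ge0.
  by lra.
have [w [_ rw wr shw]] := shallow_displacement 0 (finite_codimT X) r0
  (fun i => tol_gt0 i ltr01) (fun x => tol_loc x ltr01).
exists (0 + w) => i; have [i0|/shw[]//] := ltP 0 (depth i 0).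
apply: le_lt_trans (tol_gt0 i ltr01).
have := rP i i0; have := i0; rewrite /depth !add0r normrN.
have := lerB_normD w (- c i); rewrite normrN; lra.
Qed.

(** The factor 8 bounds the motion from stage [n] on by [4 * scale n]; the gap term keeps the motion
    from stage [m.+1] on within half of [tol (scale m) i] for radii up to [m]. *)
Fixpoint scale n : R := if n is m.+1 then
    Num.min (scale m / 8) (convexity_gap X m.+1%:R (scale m) / 16)
  else 1.

Let scale_gt0 n : 0 < scale n.
Proof.
by elim: n => //= n IH; rewrite lt_min !divr_gt0// convexity_gap_gt0.
Qed.

Let scaleS n : scale n.+1 <= scale n / 8.
Proof. by rewrite /= ge_min lexx. Qed.

Let scaleS_gap n : scale n.+1 <= convexity_gap X n.+1%:R (scale n) / 16.
Proof. by rewrite /= ge_min lexx orbT. Qed.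

Let scale_small e : 0 < e -> exists N, forall n, (N <= n)%N -> scale n < e.
Proof.
move=> e0; exists (Num.truncn e^-1) => n Nn.
have : scale n <= n.+1%:R^-1.
  elim: n {Nn} => [|n IH]; first by rewrite invr1.
  apply: le_trans (scaleS n) _.
  have : (n.+2%:R : R) <= 8 * n.+1%:R by rewrite -natr1; have := ler0n R n; rewrite -natr1; lra.
  move=> H; rewrite -[leRHS]mul1r ler_pdivlMr//.
  have : scale n * n.+1%:R <= 1 by rewrite -ler_pdivlMr// mul1r.
  have := scale_gt0 n; nra.
move=> /le_lt_trans; apply.
rewrite -[ltRHS]invrK ltf_pV2 ?posrE ?invr_gt0//.
by apply: (lt_le_trans (truncnS_gt _)); rewrite ler_nat.
Qed.

(** A node [p] of the tree has the children [p + w] and [p - w] from [branching]; the points sought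
    are limits along branches with a common prefix. *)
Lemma cantor_scheme : exists x : (nat -> bool) -> X,
  (forall a i, rho i <= `|x a - c i|) /\
  (forall a b i, `|x a - c i| <= rho i -> `|x b - c i| <= rho i -> a = b).
Proof.
pose good n p := forall i, depth i p < tol (scale n) i.
have /choice[w wP] np : exists w, good np.1 np.2 -> [/\
    scale np.1 <= `|w|, `|w| <= 2 * scale np.1,
    good np.1.+1 (np.2 + w) /\ good np.1.+1 (np.2 - w) &
    forall i, 0 < depth i np.2 -> depth i (np.2 + w) <= - tol (scale np.1) i /\
      depth i (np.2 - w) <= - tol (scale np.1) i].
  have [g|] := pselect (good np.1 np.2); last by exists 0.
  have [w [H1 H2 H3 H4]] := branching (scale_gt0 _) (scale_gt0 np.1.+1) g.
  by exists w => _; split=> //; split=> i; case: (H3 i).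
have [p0 p0P] := root.
pose pt a := fix pt n := if n is m.+1 then
  pt m + (if a m then w (m, pt m) else - w (m, pt m)) else p0.
have ptP a n : good n (pt a n).
  elim: n => [|n /(wP (n, _))[_ _ [g1 g2] _]]; first exact: p0P.
  by rewrite /=; case: (a n).
have ptS a n : `|pt a n.+1 - pt a n| <= 2 * scale n.
  have [_ + _ _] := wP (n, pt a n) (ptP a n).
  by rewrite /= addrC addKr; case: (a n); rewrite ?normrN.
have pt_near a n k : `|pt a (n + k)%N - pt a n| <= 4 * (scale n - scale (n + k)%N).
  elim: k => [|k IH]; first by rewrite addn0 !subrr normr0 mulr0.
  rewrite addnS -[X in `|X|](subrKA (pt a (n + k)%N)).
  have := ler_normD (pt a (n + k).+1 - pt a (n + k)%N) (pt a (n + k)%N - pt a n).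
  have := ptS a (n + k)%N; have := scaleS (n + k)%N; have := scale_gt0 (n + k)%N.
  lra.
have /choice[x xP] a : exists x, forall n, `|x - pt a n| <= 4 * scale n.
  have [e e0|x xP] := @cauchy_norm_cvg _ _ (pt a).
    have e4 : 0 < e / 4 by lra.
    have [N NP] := scale_small e4; exists N => n Nn.
    have := pt_near a N (n - N)%N; rewrite subnKC//.
    have := NP N (leqnn _); have := scale_gt0 n; lra.
  exists x => n; apply/ler_addgt0Pr => e e0; have [N NP] := xP e e0.
  have /NP := leq_addl n N; rewrite distrC => H1.
  have := pt_near a n N; have := scale_gt0 (n + N)%N => ? ?.
  rewrite -[X in `|X|](subrKA (pt a (n + N)%N)).
  have := ler_normD (x - pt a (n + N)%N) (pt a (n + N)%N - pt a n).
  by lra.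
have x_depth a n i : depth i (x a) <= depth i (pt a n) + 4 * scale n
    /\ depth i (pt a n) <= depth i (x a) + 4 * scale n.
  have := depth_lip i (pt a n) (x a - pt a n).
  have -> : pt a n + (x a - pt a n) = x a by rewrite addrC subrK.
  by have := xP a n => ? /andP[? ?]; split; lra.
have out a i : depth i (x a) <= 0.
  apply/ler_addgt0Pr => e e0; rewrite add0r.
  have e8 : 0 < e / 8 by lra.
  have [N /(_ N (leqnn N)) HN] := scale_small e8.
  have := convexity_gap_le X (rho i + 1) (ltW (scale_gt0 N)).
  by have := (x_depth a N i).1; have := ptP a N i; rewrite /tol; lra.
(* Two branches splitting at a deep node [pt a n] cannot end on the same ball:
   such a ball would contain that node by rotundity, hence both branches would
   have left it for good at the next step. *)
have split_ball a b n i : rho i <= n%:R -> pt a n = pt b n -> a n -> ~~ b n ->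
    0 <= depth i (x a) -> 0 <= depth i (x b) -> False.
  move=> rn eqp an bn da db.
  have [sw ws [_ _] ex] := wP (n, pt a n) (ptP a n).
  have tl : 8 * scale n.+1 <= tol (scale n) i.
    have : convexity_gap X n.+1%:R (scale n) <= convexity_gap X (rho i + 1) (scale n).
      by apply: le_convexity_gap; rewrite ?(ltW (scale_gt0 _))// -natr1 lerD2r.
    by have := scaleS_gap n; rewrite /tol; lra.
  have sS := scale_gt0 n.+1; have sn := scale_gt0 n.
  (* A ball containing the node is left by the margin [tol (scale n) i], and the later motion is at
     most half of it. *)
  have [dp|dp] := ltP 0 (depth i (pt a n)).
    have [ex1 _] := ex i dp.
    have := (x_depth a n.+1 i).1; rewrite /= an; rewrite /= in ex1.
    by move: tl sS; rewrite /=; lra.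
  have [p pE] : exists p, p = pt a n by eexists.
  have [w0 w0E] : exists w0, w0 = w (n, p) by eexists.
  rewrite -pE -?w0E in eqp sw ws ex dp.
  have xa : `|x a - (p + w0)| <= 4 * scale n.+1.
    by have <- : pt a n.+1 = p + w0 by rewrite /= an -pE w0E.
  have xb : `|x b - (p - w0)| <= 4 * scale n.+1.
    by have <- : pt b n.+1 = p - w0 by rewrite /= (negbTE bn) -eqp w0E.
  have [u uE] : exists u, x a - c i = (p - c i) + (w0 + u) /\ `|u| <= 4 * scale n.+1.
    exists (x a - (p + w0)); split=> //.
    by rewrite addrA [p - c i + w0]addrAC [RHS]addrC addrA subrK.
  have [u' u'E] : exists u', x b - c i = (p - c i) + (u' - w0) /\ `|u'| <= 4 * scale n.+1.
    exists (x b - (p - w0)); split=> //.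
    by rewrite addrCA [p - c i - w0]addrAC addrA subrK.
  have [q qE] : exists q, q = p - c i by eexists.
  move: uE u'E => [uE nu] [u'E nu']; rewrite -qE in uE u'E.
  (* Otherwise the ball contains both limits, which are far apart, so their midpoint is deep inside;
     the node, within [4 * scale n.+1] of it, is then inside too. *)
  have dist : scale n <= `|(x a - c i) - (x b - c i)|.
    have -> : (x a - c i) - (x b - c i) = 2 *: w0 + (u - u').
      rewrite uE u'E opprD addrACA subrr add0r opprB addrACA.
      by rewrite scaler_nat mulr2n.
    have := lerB_normD (2 *: w0) (u - u'); have := ler_normB u u'.
    by rewrite normrZ ger0_norm//; have := scaleS n; lra.
  have mid : 2^-1 *: ((x a - c i) + (x b - c i)) = q + 2^-1 *: (u + u').
    rewrite uE u'E addrACA [u' - w0]addrC [X in _ *: (_ + X)]addrACA subrr add0r.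
    have -> : q + q = 2 *: q by rewrite scaler_nat mulr2n.
    by rewrite scalerDr scalerA mulVf ?pnatr_eq0// scale1r.
  have := @convexity_gapP _ _ (rho i + 1) (scale n) (ltW sn) (rho i) (x a - c i) (x b - c i).
  move: da db; rewrite /depth => da db.
  have rr : rho i <= rho i + 1 by lra.
  have ra : `|x a - c i| <= rho i by lra.
  have rb : `|x b - c i| <= rho i by lra.
  move=> /(_ rr ra rb dist); rewrite mid.
  have := lerB_normD q (2^-1 *: (u + u')); have := ler_normD u u'.
  rewrite normrZ ger0_norm ?invr_ge0//.
  by move: dp tl; rewrite /depth /tol -qE; lra.
(* [split_ball] needs radii up to the splitting stage. A common prefix of length [m] keeps all
   limits so close to one point that every ball containing one has radius at most [M <= m]. *)
have [e [M [e0 eM]]] := radii (x (fun=> false)).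
have e8 : 0 < e / 8 by lra.
have [N NP] := scale_small e8.
pose m := maxn N (Num.truncn M).+1.
have mM : M <= m%:R.
  by apply: le_trans (ltW (truncnS_gt M)) _; rewrite ler_nat leq_maxr.
have me : scale m < e / 8 by apply: NP; exact: leq_maxl.
pose shift a n := if (n < m)%N then false else a (n - m)%N.
have shift_pt a : pt (shift a) m = pt (fun=> false) m.
  suff H n : (n <= m)%N -> pt (shift a) n = pt (fun=> false) n by exact: H.
  elim: n => //= n IH nm; rewrite IH ?(ltnW nm)//.
  by rewrite /shift nm.
have pt_agree a b n : (forall k, (k < n)%N -> a k = b k) -> pt a n = pt b n.
  elim: n => //= n IH ab; rewrite IH ?ab// => k kn; apply: ab; exact: ltnW.
exists (x \o shift); split=> [a i|a b i da db] /=.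
  by have := out (shift a) i; rewrite /depth subr_le0.
have {}da : 0 <= depth i (x (shift a)) by rewrite /depth subr_ge0.
have {}db : 0 <= depth i (x (shift b)) by rewrite /depth subr_ge0.
have rm : rho i <= m%:R.
  apply: le_trans mM; apply: eM.
  have := (x_depth (shift a) m i).1; have := (x_depth (fun=> false) m i).2.
  by rewrite shift_pt; lra.
apply: contrapT => /eqP ab.
have ex : exists n, a n != b n.
  apply: contrapT => H; apply: (negP ab); apply/eqP/funext => n.
  by apply: contrapT => /eqP abn; apply: H; exists n.
case: (ex_minnP ex) => n abn nmin.
have agree k : (k < n)%N -> a k = b k.
  by move=> kn; apply/eqP; apply: contraTT kn => /nmin; rewrite leqNgt.
have eqp : pt (shift a) (m + n)%N = pt (shift b) (m + n)%N.
  apply: pt_agree => k kmn; rewrite /shift; case: ltnP => // mk.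
  by apply: agree; rewrite ltn_subLR.
have rmn : rho i <= (m + n)%:R.
  by apply: le_trans rm _; rewrite ler_nat leq_addr.
have shiftE a' : shift a' (m + n)%N = a' n.
  by rewrite /shift ltnNge leq_addr addKn.
case an : (a n) abn => abn.
  by apply: (split_ball (shift a) (shift b) (m + n)%N i); rewrite ?shiftE ?an.
apply: (split_ball (shift b) (shift a) (m + n)%N i); rewrite ?shiftE ?an//.
by move: abn; case: (b n).
Qed.

End BallFamily.

(** * Coverings *)

(* Koenig: the continuum is not a countable union of smaller cardinals; here
   the [k]-th piece collects the points of rank [k] in their fibre. *)
Lemma countable_fibers_continuum (T : Type) (phi : (nat -> bool) -> T) :
  (forall d, countable [set a | phi a = d]) ->
  exists psi : (nat -> bool) -> T,
    injective psi /\ forall a, exists b, psi a = phi b.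
Proof.
move=> cphi.
have /choice[g gP] d : exists g : (nat -> bool) -> nat,
    forall a b, phi a = d -> phi b = d -> g a = g b -> a = b.
  have /countable_injP[g gi] := cphi d; exists g => a b pa pb.
  by apply: gi; rewrite inE.
pose rk a := g (phi a) a.
pose proj (k : nat) (a : nat -> bool) : nat -> bool := fun l => a (pickle (k, l)).
have [k kP] : exists k, forall y, exists a, rk a = k /\ proj k a = y.
  apply: contrapT => H.
  have /choice[y yP] k : exists y, forall a, rk a = k -> proj k a <> y.
    apply: contrapT => Hk; apply: H; exists k => y; apply: contrapT => Hy.
    by apply: Hk; exists y => a ak ay; apply: Hy; exists a.
  (* Diagonal argument: row [k] of [a] is [y k] for every [k], in particular for the rank of [a].
     Codes of no pair get [false]. *)
  pose a m := if @unpickle (nat * nat)%type m is Some kl then y kl.1 kl.2 else false.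
  apply: (yP (rk a) a erefl); apply/funext => l.
  by rewrite /proj /a pickleK.
have /choice[s sP] := kP.
exists (phi \o s); split=> [y1 y2 /= e|y]; last by exists (s y).
have [r1 p1] := sP y1; have [r2 p2] := sP y2.
rewrite -p1 -p2; congr (proj k _).
by apply: (gP (phi (s y2))) => //; rewrite -[in LHS]e -/(rk _) r1 -/(rk _) r2.
Qed.

Section Coverings.
Variables (R : realType) (X : completeNormedModType R) (F : set (set X)).
Hypothesis Xoo : infinite_dimensional X.
Hypothesis UR : uniformly_rotund X.
Hypothesis US : uniformly_smooth X.
Hypothesis ballF : forall B, F B -> is_open_ball B \/ is_closed_ball B.
Hypothesis pfF : point_finite F.

(** The members of [F] index themselves, each between the open and the closed ball of one centre and
    radius. *)
Lemma point_finite_balls_cantor : exists x : (nat -> bool) -> X,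
  (forall a B, F B -> is_open_ball B -> ~ B (x a)) /\
  (forall a b B, F B -> B (x a) -> B (x b) -> a = b).
Proof.
(* Sets outside [F] get an empty ball, of radius -1. *)
have /choice[cr crP] B : exists cr : X * R,
    [/\ F B -> B `<=` closed_ball_ Num.norm cr.1 cr.2,
        F B -> is_open_ball B -> B `<=` ball_ Num.norm cr.1 cr.2 &
        ball_ Num.norm cr.1 cr.2 `<=` [set x | F B /\ B x] ].
  have [FB|nFB] := pselect (F B); last first.
    by exists (0, -1); split=> // x; rewrite /ball_ /= => /(le_lt_trans (normr_ge0 _)); rewrite ltr0N1.
  have [[c [r [r0 BE]]]|nB] := pselect (is_open_ball B).
    exists (c, r); rewrite BE in FB *.
    by split=> [_ y yB|_ _ y yB|y yB]; [exact: ltW|exact: yB|split].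
  have [//|[c [r [r0 BE]]]] := ballF FB.
  exists (c, r); rewrite BE in FB nB *.
  by split=> [_ y yB|_ /nB|y yB]; [exact: yB|by []|split=> //; exact: ltW].
pose c B := (cr B).1; pose rho B := (cr B).2.
have pf x : finite_set [set B | 0 < depth c rho B x].
  apply: sub_finite_set (pfF x) => B /=; rewrite /depth subr_gt0 distrC.
  by have [_ _ H] := crP B => /H.
have [x [x1 x2]] := cantor_scheme Xoo UR US pf.
exists x; split=> [a B FB oB Bx|a b B FB Ba Bb].
  have [_ /(_ FB oB _ Bx) + _] := crP B.
  by rewrite /ball_ /= distrC ltNge; apply/negP/negPn; exact: x1.
have [/(_ FB) H _ _] := crP B.
by apply: (x2 a b B); rewrite distrC; apply: H.
Qed.

Lemma no_point_finite_open_ball_covering :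
  (forall B, F B -> is_open_ball B) -> ~ covering F.
Proof.
move=> oF cF; have [x [xo _]] := point_finite_balls_cantor.
have : [set: X] (x (fun=> false)) by [].
rewrite -cF => -[B FB Bx]; exact: xo FB (oF _ FB) Bx.
Qed.

(** Each branch gets a member covering its limit and a point of [D] in that member. *)
Lemma no_point_finite_ball_covering : density_lt_continuum X -> ~ covering F.
Proof.
move=> [D [dD _] [_ ltD]] cF; apply: ltD.
have [x [_ xi]] := point_finite_balls_cantor.
have /choice[B BP] a : exists B, F B /\ B (x a).
  by have : [set: X] (x a) by []; rewrite -cF => -[B ? ?]; exists B.
have /choice[d dP] a : exists d, D d /\ B a d.
  have [FB _] := BP a.
  have [c [r [r0 BE]]] : exists c r, 0 < r /\ ball c r `<=` B a.
    have [|] := ballF FB => -[c [r [r0 ->]]]; exists c, r; split=> // y;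
      rewrite -ball_normE //; exact: ltW.
  have [y [yB yD]] := dD (ball c r) (ex_intro _ c (ballxx c r0)) (ball_open c r).
  by exists y; split=> //; exact: BE.
(* Distinct branches have distinct members, of which only finitely many contain [y]. *)
have cd y : countable [set a | d a = y].
  apply: finite_set_countable.
  have Bi : {in B @^-1` [set C | F C /\ C y] &, injective B}.
    move=> a b _ _ Bab; have [FB Ba] := BP a; have [_ Bb] := BP b.
    by apply: (xi a b (B a)) => //; rewrite Bab.
  apply: sub_finite_set (finite_preimage Bi (pfF y)) => a /= <-.
  by have [FB _] := BP a; have [_ Bd] := dP a.
have [psi [psi_inj psiD]] := countable_fibers_continuum cd.
pose f (A : set nat) := psi (fun n => `[< A n >]).
have fi : {in [set: set nat] &, injective f}.
  move=> A A' _ _ /psi_inj e; apply/funext => n; apply/propext.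
  by apply: asbool_eq_equiv; exact: (congr1 (fun h => h n) e).
have fD : range f `<=` D.
  by move=> _ [A _ <-]; rewrite /f; have [b ->] := psiD (fun n => `[< A n >]); have [] := dP b.
apply: card_le_trans (subset_card_le fD).
by have := inj_card_eq fi; rewrite card_eq_le => /andP[].
Qed.

End Coverings.

Theorem theorem3p7 (R : realType) (X : completeNormedModType R) :
  infinite_dimensional X -> uniformly_rotund X -> uniformly_smooth X ->
  (density_lt_continuum X ->
     ~ exists F : set (set X),
         [/\ forall B, F B -> is_open_ball B \/ is_closed_ball B,
             covering F & point_finite F])
  /\
  (forall F : set (set X),
     (forall B, F B -> is_open_ball B) -> covering F -> ~ point_finite F).
Proof.
move=> Xoo UR US; split=> [ltc [F [bF cF pF]]|F oF cF pF].
  exact: no_point_finite_ball_covering Xoo UR US bF pF ltc cF.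
apply: (no_point_finite_open_ball_covering Xoo UR US _ pF oF cF) => B FB.
by left; exact: oF.
Qed.
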